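(* For every $\theta\in\Theta$, the min-entropy quantum functional $F_{\theta,\infty}$ on nonzero complex tensors is monotone (if $S\le T$ then $F_{\theta,\infty}(S)\le F_{\theta,\infty}(T)$), normalized ($F_{\theta,\infty}(I_r)=r$ for every $r\in\mathbb{N}$) and super-multiplicative ($F_{\theta,\infty}(S\otimes T)\ge F_{\theta,\infty}(S)F_{\theta,\infty}(T)$).
   Context: $\Theta=\{\theta\in\mathbb{R}^3_{\ge0}:\sum_i\theta_i=1\}$. For a complex tensor $T\in V_1\otimes V_2\otimes V_3$ and a nonzero matrix $M$ with singular values $\sigma_1\ge\sigma_2\ge\cdots$, $r(M)=(\sigma_j^2)_j/\sum_j\sigma_j^2$; $T_{(i)}$ is the $i$-th flattening (matrix in $V_i\otimes\bigotimes_{j\ne i}V_j$). Moment polytope $\Pi(T)=\{(r(S_{(1)}),r(S_{(2)}),r(S_{(3)})):S\in\overline{(\mathrm{GL}(V_1)\times\mathrm{GL}(V_2)\times\mathrm{GL}(V_3))\cdot T},S\ne0\}$. Min-entropy $H_\infty(q)=-\log_2\max_jq_j$. $F_{\theta,\infty}(T)=\max_{p\in\Pi(T)}2^{\sum_i\theta_iH_\infty(p_i)}$. $S\le T$ means $S=(A_1\otimes A_2\otimes A_3)T$ for linear maps $A_i$; $\otimes$ of tensors is the Kronecker product; $I_r=\sum_{i=1}^re_i\otimes e_i\otimes e_i$. *)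

(* Defs.v *)
From HB Require Import structures.
From mathcomp Require Import all_boot all_order all_algebra.
From mathcomp Require Import sesquilinear spectral.
From mathcomp Require Import complex mxtens.
From mathcomp Require Import all_classical all_reals all_analysis.

Set Implicit Arguments.
Unset Strict Implicit.
Unset Printing Implicit Defensive.

Import Order.TTheory GRing.Theory Num.Theory.
Import numFieldNormedType.Exports.
(* Function types carry the product topology. *)
Export ArrowAsProduct.

Local Open Scope classical_set_scope.
Local Open Scope ring_scope.
Local Open Scope complex_scope.
Local Open Scope sesquilinear_scope.

(* C^a (x) C^b (x) C^c in coordinates.  The alias [^o] gives R[i] its usual
   topology, so that tensors carry the Euclidean one. *)
Definition tensor (R : realType) (a b c : nat) : Type :=
  'I_a -> 'I_b -> 'I_c -> R[i]^o.

HB.instance Definition _ (R : realType) a b c :=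
  Topological.copy (tensor R a b c) ('I_a -> 'I_b -> 'I_c -> R[i]^o).
HB.instance Definition _ (R : realType) a b c :=
  GRing.Zmodule.copy (tensor R a b c) ('I_a -> 'I_b -> 'I_c -> R[i]^o).

Section Tensors.
Context {R : realType}.
Local Notation C := R[i].

Definition tapply a b c a' b' c' (A : 'M[C]_(a', a)) (B : 'M[C]_(b', b))
    (D : 'M[C]_(c', c)) (T : tensor R a b c) : tensor R a' b' c' :=
  fun i' j' k' =>
    \sum_(i < a) \sum_(j < b) \sum_(k < c) A i' i * B j' j * D k' k * T i j k.

Definition tensor_le a' b' c' a b c
    (S : tensor R a' b' c') (T : tensor R a b c) : Prop :=
  exists (A : 'M[C]_(a', a)) (B : 'M[C]_(b', b)) (D : 'M[C]_(c', c)),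
    S = tapply A B D T.

Definition GL_orbit a b c (T : tensor R a b c) : set (tensor R a b c) :=
  [set S | exists (A : 'M[C]_a) (B : 'M[C]_b) (D : 'M[C]_c),
    [/\ A \in unitmx, B \in unitmx, D \in unitmx & S = tapply A B D T]].

Definition tkron a b c a' b' c' (S : tensor R a b c) (T : tensor R a' b' c') :
    tensor R (a * a') (b * b') (c * c') :=
  fun i j k =>
    S (mxtens_unindex i).1 (mxtens_unindex j).1 (mxtens_unindex k).1 *
    T (mxtens_unindex i).2 (mxtens_unindex j).2 (mxtens_unindex k).2.

Definition flatten1 a b c (T : tensor R a b c) : 'M[C]_(a, b * c) :=
  \matrix_(i, l) T i (mxtens_unindex l).1 (mxtens_unindex l).2.
Definition flatten2 a b c (T : tensor R a b c) : 'M[C]_(b, a * c) :=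
  \matrix_(j, l) T (mxtens_unindex l).1 j (mxtens_unindex l).2.
Definition flatten3 a b c (T : tensor R a b c) : 'M[C]_(c, a * b) :=
  \matrix_(k, l) T (mxtens_unindex l).1 (mxtens_unindex l).2 k.

(* The singular values of an m x n matrix, listed as the square roots of the m
   eigenvalues of M M^*: when m > n, the last m - n entries are 0. *)
Definition singular_values m n (M : 'M[C]_(m, n)) : seq R :=
  sort >=%R
    [seq Num.sqrt (complex.Re (spectral_diag (M *m M^t*) 0 i)) | i : 'I_m].

Definition spec m n (M : 'M[C]_(m, n)) : 'rV[R]_m :=
  \row_(j < m) ((singular_values M)`_j ^+ 2 /
                \sum_(l < m) (singular_values M)`_l ^+ 2).

Definition moment_polytope a b c (T : tensor R a b c) :
    set ('rV[R]_a * 'rV[R]_b * 'rV[R]_c) :=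
  [set (spec (flatten1 S), spec (flatten2 S), spec (flatten3 S)) |
    S in [set S | closure (GL_orbit T) S /\ S != 0]].

End Tensors.

Definition unit_tensor (R : realType) (r : nat) : tensor R r r r :=
  fun i j k => ((i == j) && (j == k))%:R.
Arguments unit_tensor : clear implicits.

Section MinEntropyFunctional.
Context {R : realType}.

Definition log2 (x : R) : R := ln x / ln 2.

(* The entries of q are nonnegative in all uses, whence the neutral 0. *)
Definition min_entropy n (q : 'rV[R]_n) : R :=
  - log2 (\big[Num.max/0]_(j < n) q 0 j).

Definition Theta : set ('I_3 -> R) :=
  [set theta | (forall i, 0 <= theta i) /\ \sum_(i < 3) theta i = 1].

(* The greatest element of A; 0 if there is none. *)
Definition maximum (A : set R) : R := xget 0 [set m | A m /\ ubound A m].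

(* For T = 0 the moment polytope is empty and the value is 0. *)
Definition F_min_entropy (theta : 'I_3 -> R) a b c (T : tensor R a b c) : R :=
  maximum [set 2 `^ (theta 0 * min_entropy p.1.1
                     + theta 1 * min_entropy p.1.2
                     + theta 2 * min_entropy p.2) | p in moment_polytope T].

End MinEntropyFunctional.

(* Main.v *)
Require Import Defs.
From mathcomp Require Import all_boot all_order all_algebra.
From mathcomp Require Import sesquilinear spectral complex mxtens.
From mathcomp Require Import all_classical all_reals all_analysis.
From mathcomp Require Import ring lra.

(* Let [|.|] be the Euclidean norm of tensors.  As [sum_i theta_i = 1], the
   value of the functional at the point of the moment polytope given by [S] is
   [prod_i (|S|^2 / |S_(i)|_op^2)^theta_i].  It is continuous and invariant
   under scaling, so that it attains its maximum on the nonzero part of the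
   orbit closure, and this maximum is the supremum over the orbit.
   The value at [(A, B, D) T] only depends on [A^* A], [B^* B], [D^* D], each
   of which is also [Q^* Q] for a square matrix [Q] that is a limit of
   invertible ones.  Hence [F T] is the maximum of the values at all nonzero
   [(A, B, D) T] with rectangular [A, B, D], which gives monotonicity; combined
   with the multiplicativity of [|.|] and the submultiplicativity of the
   operator norms of the flattenings under Kronecker products, it gives
   super-multiplicativity.  Normalization is [|S|^2 <= r |S_(i)|_op^2]. *)

Set Implicit Arguments.
Unset Strict Implicit.
Unset Printing Implicit Defensive.

Import Order.TTheory GRing.Theory Num.Theory.
Import numFieldNormedType.Exports.

Local Open Scope classical_set_scope.
Local Open Scope ring_scope.
Local Open Scope complex_scope.
Local Open Scope sesquilinear_scope.

(** * Frobenius and operator norms of complex matrices *)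

Section Matrices.
Context {R : realType}.
Local Notation C := R[i].

(** The squared modulus is taken in [R] rather than [C], so that all norms live in the ordered field
    where maxima and logarithms are formed. *)
Definition abs2 (z : C) : R := complex.Re z ^+ 2 + complex.Im z ^+ 2.

Lemma abs2E z : (abs2 z)%:C = `|z| ^+ 2.
Proof. exact: add_Re2_Im2. Qed.

Lemma abs2_ge0 z : 0 <= abs2 z.
Proof. by rewrite addr_ge0 ?sqr_ge0. Qed.

Lemma abs2M (z w : C) : abs2 (z * w) = abs2 z * abs2 w.
Proof. by apply: complexI; rewrite rmorphM /= !abs2E normrM exprMn. Qed.

Lemma abs2_conj (z : C) : abs2 z^* = abs2 z.
Proof. by case: z => a b; rewrite /abs2 /= sqrrN. Qed.

Definition frob2 m n (M : 'M[C]_(m, n)) : R := \sum_i \sum_j abs2 (M i j).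

Lemma frob2E m n (M : 'M[C]_(m, n)) : (frob2 M)%:C = \tr (M *m M^t*).
Proof.
rewrite /frob2 /mxtrace rmorph_sum; apply: eq_bigr => i _.
rewrite rmorph_sum mxE; apply: eq_bigr => j _.
by rewrite !mxE /= abs2E normCK.
Qed.

Lemma frob2_ge0 m n (M : 'M[C]_(m, n)) : 0 <= frob2 M.
Proof. by apply: sumr_ge0 => i _; apply: sumr_ge0 => j _; exact: abs2_ge0. Qed.

Lemma frob2_tr m n (M : 'M[C]_(m, n)) : frob2 M^T = frob2 M.
Proof.
rewrite /frob2 exchange_big; apply: eq_bigr => i _; apply: eq_bigr => j _.
by rewrite mxE.
Qed.

Lemma frob2_adj m n (M : 'M[C]_(m, n)) : frob2 (M^t*) = frob2 M.
Proof.
rewrite -[RHS]frob2_tr; apply: eq_bigr => i _; apply: eq_bigr => j _.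
by rewrite !mxE /= abs2_conj.
Qed.

Lemma frob2Z m n (a : C) (M : 'M[C]_(m, n)) :
  frob2 (a *: M) = abs2 a * frob2 M.
Proof.
rewrite /frob2 mulr_sumr; apply: eq_bigr => i _.
by rewrite mulr_sumr; apply: eq_bigr => j _; rewrite mxE abs2M.
Qed.

Lemma frob2_eq0 m n (M : 'M[C]_(m, n)) : frob2 M = 0 -> M = 0.
Proof.
move/eqP; rewrite psumr_eq0; last first.
  by move=> i _; apply: sumr_ge0 => j _; exact: abs2_ge0.
move=> /allP H; apply/matrixP => i j; rewrite mxE.
have := H i (mem_index_enum i); rewrite psumr_eq0; last first.
  by move=> k _; exact: abs2_ge0.
move=> /allP /(_ j (mem_index_enum j)) /= /eqP Mij.
by apply/eqP; rewrite -normr_eq0 -sqrf_eq0 -abs2E Mij.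
Qed.

Lemma mul_adj m n p (A : 'M[C]_(m, n)) (B : 'M[C]_(n, p)) :
  (A *m B)^t* = B^t* *m A^t*.
Proof. by rewrite trmx_mul map_mxM. Qed.

Lemma frob2_gram m n p (M : 'M[C]_(m, n)) (N : 'M[C]_(m, p)) :
  M *m M^t* = N *m N^t* -> frob2 M = frob2 N.
Proof. by move=> MN; apply: complexI; rewrite !frob2E MN. Qed.

Lemma frob2_unitary m n (P : 'M[C]_m) (M : 'M[C]_(m, n)) :
  P \is unitarymx -> frob2 (P *m M) = frob2 M.
Proof.
move=> Pu; apply: complexI; rewrite !frob2E mul_adj mulmxA mxtrace_mulC.
by rewrite !mulmxA -invmx_unitary // mulVmx ?mul1mx ?unitarymx_unit.
Qed.

Lemma frob2_rows m n (M : 'M[C]_(m, n)) : frob2 M = \sum_i frob2 (row i M).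
Proof.
apply: eq_bigr => i _; rewrite /frob2 big_ord1.
by apply: eq_bigr => j _; rewrite mxE.
Qed.

(** The squared singular values, in the unsorted order of the spectral theorem; only their sum and
    maximum matter. *)
Definition sdiag m n (M : 'M[C]_(m, n)) (i : 'I_m) : R :=
  complex.Re (spectral_diag (M *m M^t*) 0 i).

(* The square of the largest singular value of [M]. *)
Definition opnorm2 m n (M : 'M[C]_(m, n)) : R := \big[Num.max/0]_i sdiag M i.

Local Notation P M := (spectralmx (M *m M^t*)).

(** Conjugating [M *m M^t*] by its unitary eigenbasis diagonalizes it, so the rows of [P M *m M] are
    pairwise orthogonal. *)
Lemma spectral_gram m n (M : 'M[C]_(m, n)) :
  (P M *m M) *m (P M *m M)^t* = diag_mx (spectral_diag (M *m M^t*)).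
Proof.
have PU : P M \is unitarymx by exact: spectral_unitarymx.
have nM : M *m M^t* \is normalmx.
  by apply/normalmxP; rewrite mul_adj trmxCK.
have /orthomx_spectralP := nM.
rewrite mul_adj mulmxA -[_ *m M *m _]mulmxA.
move: (P M) (spectral_diag _) PU => Q D QU ->.
by rewrite !mulmxA mulmxV ?unitarymx_unit // mul1mx mulmxtVK.
Qed.

(** Reading off the diagonal of [spectral_gram] shows that the eigenvalues are real and
    nonnegative. *)
Lemma spectral_sdiag m n (M : 'M[C]_(m, n)) i :
  spectral_diag (M *m M^t*) 0 i = (frob2 (row i (P M *m M)))%:C.
Proof.
have /matrixP/(_ i i) := spectral_gram M.
rewrite [X in _ = X]mxE eqxx mulr1n => <-.
rewrite mxE /frob2 big_ord1 rmorph_sum; apply: eq_bigr => j _.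
by rewrite !mxE /= abs2E normCK.
Qed.

Lemma sdiagE m n (M : 'M[C]_(m, n)) i : sdiag M i = frob2 (row i (P M *m M)).
Proof. by rewrite /sdiag spectral_sdiag. Qed.

Lemma sdiag_ge0 m n (M : 'M[C]_(m, n)) i : 0 <= sdiag M i.
Proof. by rewrite sdiagE frob2_ge0. Qed.

Lemma sum_sdiag m n (M : 'M[C]_(m, n)) : \sum_i sdiag M i = frob2 M.
Proof.
rewrite -(frob2_unitary M (spectral_unitarymx (M *m M^t*))) frob2_rows.
by apply: eq_bigr => i _; rewrite sdiagE.
Qed.

Lemma sdiag_le_opnorm2 m n (M : 'M[C]_(m, n)) i : sdiag M i <= opnorm2 M.
Proof. exact: le_bigmax. Qed.

Lemma opnorm2_ge0 m n (M : 'M[C]_(m, n)) : 0 <= opnorm2 M.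
Proof. exact: bigmax_ge_id. Qed.

Lemma frob2_mul_spectral m n p (y : 'M[C]_(p, m)) (M : 'M[C]_(m, n)) :
  frob2 (y *m (P M *m M)) = \sum_k \sum_i abs2 (y k i) * sdiag M i.
Proof.
apply: complexI; rewrite frob2E mul_adj mulmxA -[y *m _ *m _]mulmxA.
rewrite spectral_gram /mxtrace rmorph_sum; apply: eq_bigr => k _.
rewrite mxE rmorph_sum; apply: eq_bigr => i _.
rewrite mul_mx_diag !mxE rmorphM /= abs2E normCK spectral_sdiag -sdiagE.
by rewrite mulrAC.
Qed.

(** In the eigenbasis, [frob2 (x *m M)] is a sum of squared coordinates weighted by the [sdiag M i],
    each at most [opnorm2 M]. Allowing several rows in [x] lets the bound apply to products of
    matrices. *)
Lemma frob2_mulmx_le m n p (x : 'M[C]_(p, m)) (M : 'M[C]_(m, n)) :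
  frob2 (x *m M) <= opnorm2 M * frob2 x.
Proof.
have PU : P M \is unitarymx by exact: spectral_unitarymx.
have -> : frob2 x = frob2 (x *m (P M)^t*).
  rewrite -[RHS]frob2_adj mul_adj trmxCK frob2_unitary //.
  by rewrite frob2_adj.
have -> : x *m M = (x *m (P M)^t*) *m (P M *m M).
  by rewrite !mulmxA -invmx_unitary // mulmxKV // unitarymx_unit.
rewrite frob2_mul_spectral /frob2 mulr_sumr; apply: ler_sum => k _.
rewrite mulr_sumr; apply: ler_sum => i _.
by rewrite mulrC ler_wpM2r ?abs2_ge0 // sdiag_le_opnorm2.
Qed.

(** A row of the unitary eigenbasis for the top eigenvalue works. The eigenvector equation, stronger
    than attaining the norm, is what [opnorm2_adj_le] needs. *)
Lemma opnorm2_attained m n (M : 'M[C]_(m, n)) : (0 < m)%N ->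
  exists2 x : 'rV[C]_m, frob2 x = 1 & x *m (M *m M^t*) = (opnorm2 M)%:C *: x.
Proof.
move=> m0.
have [i _ topi] := @eq_bigmax _ R _ 0 (Ordinal m0) xpredT (sdiag M) isT
  (fun i _ => sdiag_ge0 M i).
exists (row i (P M)).
  apply: complexI; rewrite frob2E.
  have /matrixP/(_ i i) := unitarymxP (spectral_unitarymx (M *m M^t*)).
  rewrite !mxE eqxx => E; rewrite [RHS]/= -[RHS]E /mxtrace big_ord1 mxE.
  by apply: eq_bigr => j _; rewrite !mxE.
have PU : P M \is unitarymx by exact: spectral_unitarymx.
have := spectral_gram M; rewrite mul_adj mulmxA -[_ *m M *m _]mulmxA.
move=> /(congr1 (mulmx^~ (P M))); rewrite mulmxKtV // => E.
rewrite -row_mul E row_mul row_diag_mx -scalemxAl -rowE spectral_sdiag.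
by rewrite -sdiagE /opnorm2 topi.
Qed.

Lemma opnorm2_attained_frob2 m n (M : 'M[C]_(m, n)) : (0 < m)%N ->
  exists2 x : 'rV[C]_m, frob2 x = 1 & frob2 (x *m M) = opnorm2 M.
Proof.
move=> /(opnorm2_attained M)[x x1 xM]; exists x => //; apply: complexI.
rewrite frob2E mul_adj mulmxA -[x *m M *m _]mulmxA xM -scalemxAl mxtraceZ.
by rewrite -frob2E x1 mulr1.
Qed.

Lemma opnorm2_le m n (M : 'M[C]_(m, n)) c : 0 <= c ->
  (forall x : 'rV_m, frob2 (x *m M) <= c * frob2 x) -> opnorm2 M <= c.
Proof.
move=> c0 Mc; have [m0|m0] := posnP m.
  by move: M Mc; rewrite m0 => M _; rewrite /opnorm2 big_ord0.
have [x x1 <-] := opnorm2_attained_frob2 M m0.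
by rewrite (le_trans (Mc x)) // x1 mulr1.
Qed.

Lemma opnorm2_gram m n p (M : 'M[C]_(m, n)) (N : 'M[C]_(m, p)) :
  M *m M^t* = N *m N^t* -> opnorm2 M = opnorm2 N.
Proof. by move=> MN; rewrite /opnorm2 /sdiag MN. Qed.

(** Let [t] be [opnorm2 M] and [x] a unit eigenvector for [t]. Then [x *m M] has squared norm [t]
    and is sent by [M^t*] to a vector of squared norm [t ^+ 2]; divide by [t]. *)
Lemma opnorm2_adj_le m n (M : 'M[C]_(m, n)) : opnorm2 M <= opnorm2 (M^t*).
Proof.
have [m0|m0] := posnP m.
  by move: M; rewrite m0 => M; rewrite {1}/opnorm2 big_ord0 opnorm2_ge0.
have [x x1 xM] := opnorm2_attained M m0.
have fxM : frob2 (x *m M) = opnorm2 M.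
  apply: complexI; rewrite frob2E mul_adj mulmxA -[x *m M *m _]mulmxA xM.
  by rewrite -scalemxAl mxtraceZ -frob2E x1 mulr1.
have := frob2_mulmx_le (x *m M) (M^t*).
rewrite -mulmxA xM fxM frob2Z x1 mulr1 /abs2 /= expr0n addr0 expr2.
have := opnorm2_ge0 M; rewrite le_eqVlt.
move=> /predU1P[<- _|t0]; first exact: opnorm2_ge0.
by rewrite ler_pM2r.
Qed.

Lemma opnorm2_adj m n (M : 'M[C]_(m, n)) : opnorm2 (M^t*) = opnorm2 M.
Proof.
by apply/eqP; rewrite eq_le opnorm2_adj_le andbT -{2}[M]trmxCK opnorm2_adj_le.
Qed.

Lemma frob2_le_opnorm2 m n (M : 'M[C]_(m, n)) : frob2 M <= m%:R * opnorm2 M.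
Proof.
rewrite -sum_sdiag (le_trans (ler_sum _ (fun i _ => sdiag_le_opnorm2 M i))) //.
by rewrite sumr_const card_ord mulr_natl.
Qed.

Lemma opnorm2_le_frob2 m n (M : 'M[C]_(m, n)) : opnorm2 M <= frob2 M.
Proof.
rewrite -sum_sdiag; apply: bigmax_le => [|i _].
  by apply: sumr_ge0 => i _; exact: sdiag_ge0.
by rewrite (bigD1 i) //= lerDl sumr_ge0 // => j _; exact: sdiag_ge0.
Qed.

Lemma opnorm2Z_le m n (a : C) (M : 'M[C]_(m, n)) :
  opnorm2 (a *: M) <= abs2 a * opnorm2 M.
Proof.
apply: opnorm2_le => [|x]; first by rewrite mulr_ge0 ?abs2_ge0 ?opnorm2_ge0.
rewrite -scalemxAr frob2Z -mulrA ler_wpM2l ?abs2_ge0 //.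
exact: frob2_mulmx_le.
Qed.

(** An entrywise weighted inequality that replaces Cauchy-Schwarz: choosing [e] as the ratio of the
    norms recovers the triangle inequality. *)
Lemma frob2D m n (M N : 'M[C]_(m, n)) (e : R) : 0 < e ->
  frob2 (M + N) <= (1 + e) * frob2 M + (1 + e^-1) * frob2 N.
Proof.
move=> e0.
have sqD (a b : R) :
    (a + b) ^+ 2 <= (1 + e) * a ^+ 2 + (1 + e^-1) * b ^+ 2.
  rewrite -subr_ge0.
  have -> : (1 + e) * a ^+ 2 + (1 + e^-1) * b ^+ 2 - (a + b) ^+ 2
    = (e * a - b) ^+ 2 / e by field; rewrite gt_eqF.
  by rewrite divr_ge0 ?sqr_ge0 ?ltW.
rewrite /frob2 !mulr_sumr -big_split; apply: ler_sum => i _.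
rewrite !mulr_sumr -big_split; apply: ler_sum => j _ /=.
rewrite mxE /abs2; move: (M i j) (N i j) => [a b] [c d] /=.
by rewrite !mulrDr addrACA lerD.
Qed.

(** A triangle inequality with the coarser Frobenius norm on the perturbation [N], which is enough
    for continuity. *)
Lemma opnorm2D m n (M N : 'M[C]_(m, n)) :
  Num.sqrt (opnorm2 (M + N)) <= Num.sqrt (opnorm2 M) + Num.sqrt (frob2 N).
Proof.
(* The weight used below is a quotient of the two norms, so vanishing norms are treated first. *)
have [M0|MN0] := eqVneq (opnorm2 M) 0.
  rewrite M0 sqrtr0 add0r ler_wsqrtr //.
  have := frob2_le_opnorm2 M; rewrite M0 mulr0 => fM.
  have /frob2_eq0-> : frob2 M = 0 by apply/eqP; rewrite eq_le fM frob2_ge0.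
  by rewrite add0r opnorm2_le_frob2.
have [/frob2_eq0->|N0] := eqVneq (frob2 N) 0.
  by rewrite addr0 lerDl sqrtr_ge0.
have sM : 0 < Num.sqrt (opnorm2 M)
  by rewrite sqrtr_gt0 lt_neqAle eq_sym MN0 opnorm2_ge0.
have sN : 0 < Num.sqrt (frob2 N).
  by rewrite sqrtr_gt0 lt_neqAle eq_sym N0 frob2_ge0.
have sMN0 := addr_ge0 (ltW sM) (ltW sN).
rewrite -[leRHS]ger0_norm // -sqrtr_sqr ler_wsqrtr //.
set s := Num.sqrt (opnorm2 M) in sM sMN0 *.
set t := Num.sqrt (frob2 N) in sN sMN0 *.
apply: opnorm2_le => [|x]; first exact: sqr_ge0.
(* The optimal weight: with it the bound of [frob2D] becomes exactly [(s + t) ^+ 2 * frob2 x]. *)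
have e0 : 0 < t / s by rewrite divr_gt0.
rewrite mulmxDr (le_trans (frob2D _ _ e0)) //.
have -> : (s + t) ^+ 2 * frob2 x = (1 + t / s) * (s ^+ 2 * frob2 x)
    + (1 + (t / s)^-1) * (t ^+ 2 * frob2 x).
  by field; rewrite !gt_eqF.
rewrite /s /t !sqr_sqrtr ?opnorm2_ge0 ?frob2_ge0 // -/s -/t.
rewrite lerD // ler_wpM2l ?frob2_mulmx_le //.
- by rewrite addr_ge0 // ltW.
- by rewrite addr_ge0 // ltW // invr_gt0.
rewrite (le_trans (frob2_mulmx_le _ _)) // ler_wpM2r ?frob2_ge0 //.
exact: opnorm2_le_frob2.
Qed.

Lemma sqrt_opnorm2_dist m n (M N : 'M[C]_(m, n)) :
  `|Num.sqrt (opnorm2 M) - Num.sqrt (opnorm2 N)| <= Num.sqrt (frob2 (M - N)).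
Proof.
have H (A B : 'M[C]_(m, n)) :
    Num.sqrt (opnorm2 A) - Num.sqrt (opnorm2 B) <= Num.sqrt (frob2 (A - B)).
  by rewrite lerBlDl -{1}(subrKC B A) opnorm2D.
rewrite ler_norml H andbT lerNl opprB (le_trans (H _ _)) //.
rewrite -opprB -scaleN1r frob2Z.
by rewrite /abs2 /= oppr0 expr0n addr0 sqrrN expr1n mul1r.
Qed.

(* [Q] is the square root of [A^* A] up to a unitary factor [U], which makes
   [Q] a limit of invertible matrices along the line directed by [U]. *)
Lemma gram_root m n (A : 'M[C]_(m, n)) :
  exists Q U : 'M[C]_n, [/\ A^t* *m A = Q^t* *m Q &
    forall e : R, 0 < e -> Q + e%:C *: U \in unitmx].
Proof.
pose M := A^t*; have PU : P M \is unitarymx by exact: spectral_unitarymx.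
have MM : M *m M^t* = A^t* *m A by rewrite /M trmxCK.
have nM : M *m M^t* \is normalmx by apply/normalmxP; rewrite mul_adj trmxCK.
pose d : 'rV[C]_n := \row_i (Num.sqrt (sdiag M i))%:C.
exists (diag_mx d *m P M), (P M); split.
  rewrite -MM [LHS](orthomx_spectralP nM) mul_adj invmx_unitary //.
  rewrite -!mulmxA; congr (_ *m _); rewrite !mulmxA; congr (_ *m _).
  apply/matrixP => i j; rewrite mul_mx_diag !mxE.
  have [<-|ij] := eqVneq j i; last by rewrite !mulr0n /= rmorph0 mul0r.
  rewrite !mulr1n spectral_sdiag -sdiagE -{1}[sdiag M j]sqr_sqrtr ?sdiag_ge0 //.
  by rewrite rmorphXn expr2 /=; congr (_ * _); exact/esym/conjc_real.
move=> e e0.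
(* The entries of [d] are nonnegative, so adding [e] makes the diagonal factor invertible. *)
have -> : diag_mx d *m P M + e%:C *: P M = diag_mx (d + const_mx e%:C) *m P M.
  by rewrite linearD /= diag_const_mx mulmxDl mul_scalar_mx.
rewrite unitmx_mul (unitarymx_unit PU) andbT unitmxE det_diag unitfE.
apply/prodf_neq0 => i _; rewrite !mxE -rmorphD /=.
by rewrite (_ : 0 = 0%:C) // (inj_eq (@complexI _)) gt_eqF //
   ltr_wpDl ?sqrtr_ge0.
Qed.
End Matrices.

(** * Tensors, their flattenings and Kronecker products *)

Section TensorAlgebra.
Context {R : realType}.
Local Notation C := R[i].

(** Both norms depend only on the Gram matrix [M *m M^t*], which handles the right factor; they are
    invariant under adjoints, which turns the left factor into a right one. *)
Lemma gram_sandwich m1 m2 m n1 n2 n (A : 'M[C]_(m1, m)) (Q : 'M[C]_(m2, m))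
    (K : 'M[C]_(n1, n)) (L : 'M[C]_(n2, n)) (X : 'M[C]_(m, n)) :
    A^t* *m A = Q^t* *m Q -> K^t* *m K = L^t* *m L ->
  opnorm2 (A *m X *m K^T) = opnorm2 (Q *m X *m L^T) /\
  frob2 (A *m X *m K^T) = frob2 (Q *m X *m L^T).
Proof.
move=> AQ KL.
have KLT : K^T *m K^T^t* = L^T *m L^T^t*.
  have trE p (N : 'M[C]_(p, n)) : N^T *m N^T^t* = (N^t* *m N)^T.
    by rewrite trmx_mul -map_trmx.
  by rewrite !trE KL.
have right (Y : 'M[C]_(m1, n)) :
    (Y *m K^T) *m (Y *m K^T)^t* = (Y *m L^T) *m (Y *m L^T)^t*.
  by rewrite !mul_adj -!mulmxA; congr (_ *m _); rewrite !mulmxA KLT.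
have left (Z : 'M[C]_(m, n2)) : (A *m Z)^t* *m (A *m Z)^t* ^t* =
    (Q *m Z)^t* *m (Q *m Z)^t* ^t*.
  by rewrite !trmxCK !mul_adj -!mulmxA; congr (_ *m _); rewrite !mulmxA AQ.
split.
  rewrite (opnorm2_gram (right _)) -!mulmxA -opnorm2_adj.
  rewrite (opnorm2_gram (left _)).
  by rewrite opnorm2_adj.
rewrite (frob2_gram (right _)) -!mulmxA -frob2_adj (frob2_gram (left _)).
by rewrite frob2_adj.
Qed.

Lemma big_mxtens_index (V : nmodType) m n (F : 'I_(m * n) -> V) :
  \sum_l F l = \sum_i \sum_j F (mxtens_index (i, j)).
Proof.
rewrite pair_bigA /= (reindex (@mxtens_index m n)) /=.
  by apply: eq_bigr => -[].
exists (@mxtens_unindex m n) => x _; first exact: mxtens_indexK.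
exact: mxtens_unindexK.
Qed.

Lemma big_mxtens (V : nmodType) m n (F : 'I_m -> 'I_n -> V) :
  \sum_(l < m * n) F (mxtens_unindex l).1 (mxtens_unindex l).2 =
  \sum_i \sum_j F i j.
Proof.
rewrite big_mxtens_index; apply: eq_bigr => i _; apply: eq_bigr => j _.
by rewrite mxtens_indexK.
Qed.

Definition tnorm2 a b c (S : tensor R a b c) : R :=
  \sum_i \sum_j \sum_k abs2 (S i j k).

(** [swap12] and [rot3] bring the second or third mode to the front and keep the order of the other
    two, so that every flattening is a [flatten1] by computation and only the first mode needs
    study. *)
Definition swap12 a b c (S : tensor R a b c) : tensor R b a c :=
  fun j i k => S i j k.

Definition rot3 a b c (S : tensor R a b c) : tensor R c a b :=
  fun k i j => S i j k.

Lemma flatten2E a b c (S : tensor R a b c) : flatten2 S = flatten1 (swap12 S).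
Proof. by []. Qed.

Lemma flatten3E a b c (S : tensor R a b c) : flatten3 S = flatten1 (rot3 S).
Proof. by []. Qed.

Lemma frob2_flatten1 a b c (S : tensor R a b c) : frob2 (flatten1 S) = tnorm2 S.
Proof.
apply: eq_bigr => i _; rewrite -(big_mxtens (fun j k => abs2 (S i j k))).
by apply: eq_bigr => l _; rewrite mxE.
Qed.

Lemma tnorm2_swap12 a b c (S : tensor R a b c) : tnorm2 (swap12 S) = tnorm2 S.
Proof. by rewrite /tnorm2 exchange_big. Qed.

Lemma tnorm2_rot3 a b c (S : tensor R a b c) : tnorm2 (rot3 S) = tnorm2 S.
Proof.
rewrite /tnorm2 exchange_big; apply: eq_bigr => i _ /=.
by rewrite exchange_big.
Qed.

Lemma tnorm2_ge0 a b c (S : tensor R a b c) : 0 <= tnorm2 S.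
Proof. by rewrite -frob2_flatten1 frob2_ge0. Qed.

Lemma flatten1_inj a b c : injective (@flatten1 R a b c).
Proof.
move=> S T /matrixP ST; apply/funext => i; apply/funext => j; apply/funext => k.
by have := ST i (mxtens_index (j, k)); rewrite !mxE mxtens_indexK.
Qed.

Lemma tnorm2_eq0 a b c (S : tensor R a b c) : (tnorm2 S == 0) = (S == 0).
Proof.
apply/eqP/eqP => [|->].
  rewrite -frob2_flatten1 => /frob2_eq0 S0; apply: flatten1_inj.
  by rewrite S0; apply/matrixP => i l; rewrite !mxE.
rewrite /tnorm2; apply: big1 => i _; apply: big1 => j _; apply: big1 => k _.
by rewrite /abs2 /= expr0n addr0.
Qed.

Lemma tnorm2_gt0 a b c (S : tensor R a b c) : (0 < tnorm2 S) = (S != 0).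
Proof. by rewrite lt_def tnorm2_ge0 andbT tnorm2_eq0. Qed.

(** With the injectivity of [flatten1], this turns identities on tensors into matrix algebra. *)
Lemma flatten1_tapply a b c a' b' c' (A : 'M[C]_(a', a)) (B : 'M[C]_(b', b))
    (D : 'M[C]_(c', c)) (T : tensor R a b c) :
  flatten1 (tapply A B D T) = A *m flatten1 T *m (B *t D)^T.
Proof.
apply/matrixP => i' l'; rewrite mxE /tapply exchange_big /=.
under eq_bigr do rewrite exchange_big /=.
rewrite -big_mxtens mxE; apply: eq_bigr => l _.
rewrite !mxE big_distrl; apply: eq_bigr => i _ /=.
rewrite !mxE /=. ring.
Qed.

Lemma tapply_comp a b c a' b' c' a'' b'' c''
    (A : 'M[C]_(a'', a')) (B : 'M[C]_(b'', b')) (D : 'M[C]_(c'', c'))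
    (A' : 'M[C]_(a', a)) (B' : 'M[C]_(b', b)) (D' : 'M[C]_(c', c))
    (T : tensor R a b c) :
  tapply A B D (tapply A' B' D' T) = tapply (A *m A') (B *m B') (D *m D') T.
Proof.
apply: flatten1_inj; rewrite !flatten1_tapply -tensmx_mul trmx_mul.
by rewrite !mulmxA.
Qed.

Lemma swap12_tapply a b c a' b' c' (A : 'M[C]_(a', a)) (B : 'M[C]_(b', b))
    (D : 'M[C]_(c', c)) (T : tensor R a b c) :
  swap12 (tapply A B D T) = tapply B A D (swap12 T).
Proof.
apply/funext => j'; apply/funext => i'; apply/funext => k'.
rewrite /swap12 /tapply exchange_big; apply: eq_bigr => j _.
by apply: eq_bigr => i _; apply: eq_bigr => k _; rewrite [A _ _ * _]mulrC.
Qed.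

Lemma rot3_tapply a b c a' b' c' (A : 'M[C]_(a', a)) (B : 'M[C]_(b', b))
    (D : 'M[C]_(c', c)) (T : tensor R a b c) :
  rot3 (tapply A B D T) = tapply D A B (rot3 T).
Proof.
apply/funext => k'; apply/funext => i'; apply/funext => j'.
rewrite /rot3 /tapply; under eq_bigr do rewrite exchange_big /=.
rewrite exchange_big; apply: eq_bigr => k _.
apply: eq_bigr => i _; apply: eq_bigr => j _; congr (_ * _).
by rewrite mulrC mulrA.
Qed.

Lemma tapply_gram a b c a1 b1 c1 a2 b2 c2 (A : 'M[C]_(a1, a))
    (B : 'M[C]_(b1, b)) (D : 'M[C]_(c1, c)) (A' : 'M[C]_(a2, a))
    (B' : 'M[C]_(b2, b)) (D' : 'M[C]_(c2, c)) (T : tensor R a b c) :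
    A^t* *m A = A'^t* *m A' -> B^t* *m B = B'^t* *m B' ->
    D^t* *m D = D'^t* *m D' ->
  opnorm2 (flatten1 (tapply A B D T)) =
    opnorm2 (flatten1 (tapply A' B' D' T)) /\
  tnorm2 (tapply A B D T) = tnorm2 (tapply A' B' D' T).
Proof.
move=> AA BB DD; rewrite -!frob2_flatten1 !flatten1_tapply.
apply: gram_sandwich => //.
by rewrite !trmx_tens !map_mxT !tensmx_mul BB DD.
Qed.

Lemma tnorm2_kron a b c a' b' c' (S : tensor R a b c) (T : tensor R a' b' c') :
  tnorm2 (tkron S T) = tnorm2 S * tnorm2 T.
Proof.
rewrite /tnorm2 big_distrlr /= -[RHS]big_mxtens; apply: eq_bigr => i _.
rewrite big_distrlr /= -[RHS]big_mxtens; apply: eq_bigr => j _.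
rewrite big_distrlr /= -[RHS]big_mxtens; apply: eq_bigr => k _.
by rewrite abs2M.
Qed.

Lemma tapply_kron a b c a1 b1 c1 a' b' c' a1' b1' c1'
    (A : 'M[C]_(a1, a)) (B : 'M[C]_(b1, b)) (D : 'M[C]_(c1, c))
    (A' : 'M[C]_(a1', a')) (B' : 'M[C]_(b1', b')) (D' : 'M[C]_(c1', c'))
    (S : tensor R a b c) (T : tensor R a' b' c') :
  tapply (A *t A') (B *t B') (D *t D') (tkron S T) =
  tkron (tapply A B D S) (tapply A' B' D' T).
Proof.
apply/funext => i1; apply/funext => j1; apply/funext => k1.
rewrite /tkron /tapply big_distrlr /= -[RHS]big_mxtens; apply: eq_bigr => i _.
rewrite big_distrlr /= -[RHS]big_mxtens; apply: eq_bigr => j _.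
rewrite big_distrlr /= -[RHS]big_mxtens; apply: eq_bigr => k _.
rewrite !mxE; ring.
Qed.

(** Up to a permutation of columns, the flattening of [tkron S T] is the Kronecker product of the
    flattenings. Reshaping the vector [x] into a matrix [X] makes its action a two-sided product,
    and each side is bounded by [frob2_mulmx_le]. *)
Lemma opnorm2_kron a b c a' b' c' (S : tensor R a b c) (T : tensor R a' b' c') :
  opnorm2 (flatten1 (tkron S T)) <= opnorm2 (flatten1 S) * opnorm2 (flatten1 T).
Proof.
apply: opnorm2_le => [|x]; first by rewrite mulr_ge0 ?opnorm2_ge0.
pose X : 'M[C]_(a, a') := \matrix_(i, i') x 0 (mxtens_index (i, i')).
have frobX : frob2 X = frob2 x.
  rewrite [RHS]big_ord1 /frob2 -[LHS]big_mxtens; apply: eq_bigr => l _.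
  by rewrite mxE -surjective_pairing mxtens_unindexK.
have -> : frob2 (x *m flatten1 (tkron S T)) =
    frob2 ((flatten1 S)^T *m X *m flatten1 T).
  (* The column permutation: the left side groups the indices by mode, the right side by tensor
     factor. *)
  have E (j : 'I_b) (j' : 'I_b') (k : 'I_c) (k' : 'I_c') :
      (x *m flatten1 (tkron S T)) 0
        (mxtens_index (mxtens_index (j, j'), mxtens_index (k, k'))) =
      ((flatten1 S)^T *m X *m flatten1 T) (mxtens_index (j, k))
        (mxtens_index (j', k')).
    rewrite !mxE.
    under [RHS]eq_bigr do rewrite mxE big_distrl /=.
    rewrite exchange_big -[RHS]big_mxtens; apply: eq_bigr => l _ /=.
    rewrite !mxE !mxtens_indexK /tkron !mxtens_indexK /=.
    rewrite (_ : mxtens_index (Ordinal _, _) = l); first by ring.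
    exact: mxtens_unindexK.
  pose G := (flatten1 S)^T *m X *m flatten1 T.
  rewrite [LHS]big_ord1 [LHS]big_mxtens_index [LHS]big_mxtens_index.
  rewrite [RHS]big_mxtens_index; apply: eq_bigr => j _.
  under eq_bigr do rewrite big_mxtens_index.
  under [RHS]eq_bigr do rewrite big_mxtens_index.
  rewrite exchange_big; apply: eq_bigr => k _.
  by apply: eq_bigr => j' _; apply: eq_bigr => k' _; rewrite E.
rewrite -frobX; apply: (le_trans (frob2_mulmx_le _ _)).
rewrite -mulrA mulrCA ler_wpM2l ?opnorm2_ge0 //.
(* Transposing moves [flatten1 S] to the right, where the operator norm bound applies. *)
by rewrite -frob2_tr trmx_mul trmxK -(frob2_tr X) frob2_mulmx_le.
Qed.
Lemma tapply0 a b c a' b' c' (A : 'M[C]_(a', a)) (B : 'M[C]_(b', b))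
    (D : 'M[C]_(c', c)) : tapply A B D (0 : tensor R a b c) = 0.
Proof.
have fl0 p q r : flatten1 (0 : tensor R p q r) = 0.
  by apply/matrixP => i l; rewrite !mxE.
by apply: flatten1_inj; rewrite flatten1_tapply !fl0 mulmx0 mul0mx.
Qed.

Lemma tapply1 a b c (T : tensor R a b c) : tapply 1%:M 1%:M 1%:M T = T.
Proof.
have t1 : (1%:M : 'M[C]_b) *t (1%:M : 'M[C]_c) = 1%:M.
  apply/matrixP => l l'; rewrite !mxE -natrM mulnb; congr (_%:R : C).
  by rewrite -[in RHS](mxtens_unindexK l) -[in RHS](mxtens_unindexK l')
    (inj_eq (can_inj (@mxtens_indexK b c))).
by apply: flatten1_inj; rewrite flatten1_tapply t1 trmx1 mulmx1 mul1mx.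
Qed.

Lemma abs2_le_tnorm2 a b c (S : tensor R a b c) i j k :
  abs2 (S i j k) <= tnorm2 S.
Proof.
have le_sum (I : finType) (f : I -> R) i0 :
    (forall i1, 0 <= f i1) -> f i0 <= \sum_i1 f i1.
  by move=> f0; rewrite (bigD1 i0) //= lerDl sumr_ge0.
have abs2_ge0' i1 j1 k1 : 0 <= abs2 (S i1 j1 k1) by exact: abs2_ge0.
apply: le_trans (le_sum _ (fun i => \sum_j \sum_k abs2 (S i j k)) i _).
  apply: le_trans (le_sum _ (fun j => \sum_k abs2 (S i j k)) j _).
    exact: (le_sum _ (fun k => abs2 (S i j k)) k).
  by move=> j1; apply: sumr_ge0.
by move=> i1; apply: sumr_ge0 => j1 _; apply: sumr_ge0.
Qed.

End TensorAlgebra.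

(** * The objective function on single tensors *)

Section Values.
Context {R : realType}.
Local Notation C := R[i].

Lemma size_singular_values m n (M : 'M[C]_(m, n)) :
  size (singular_values M) = m.
Proof. by rewrite /singular_values size_sort size_map -cardE card_ord. Qed.

(** Sorting only permutes the values, so any commutative law ignores it; the general [op] covers
    both the sum and the maximum. *)
Lemma big_singular_values m n (M : 'M[C]_(m, n)) x0 (op : SemiGroup.com_law R) :
  \big[op/x0]_(l < m) (singular_values M)`_l ^+ 2 =
  \big[op/x0]_i sdiag M i.
Proof.
have [s sE] : exists s, s = singular_values M by exists (singular_values M).
have szs : size s = m by rewrite sE size_singular_values.
rewrite -sE -(big_mkord xpredT (fun l => s`_l ^+ 2)) -{1}szs.
rewrite -(big_nth 0 xpredT (fun x => x ^+ 2)) sE.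
rewrite (perm_big _ (permEl (perm_sort _ _))) /= big_map big_enum /=.
by apply: eq_bigr => i _; rewrite sqr_sqrtr ?sdiag_ge0.
Qed.

Lemma max_spec m n (M : 'M[C]_(m, n)) :
  \big[Num.max/0]_(j < m) spec M 0 j = opnorm2 M / frob2 M.
Proof.
rewrite /opnorm2 -(big_singular_values M 0 Num.max) -sum_sdiag.
rewrite -(big_singular_values M 0 +%R).
set s := \sum_(l < m) _; have s0 : 0 <= s^-1.
  by rewrite invr_ge0 sumr_ge0 // => i _; exact: sqr_ge0.
rewrite (big_morph (fun x => x * s^-1) (id1 := 0) (op1 := Num.max)).
- by apply: eq_bigr => j _; rewrite mxE.
- by move=> x y; rewrite maxr_pMl.
- by rewrite mul0r.
Qed.

(** By [max_spec], the largest entry of [spec (flatten1 S)]; thus [- ln (rho S)] is its min-entropy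
    up to the factor [ln 2]. *)
Definition rho a b c (S : tensor R a b c) : R :=
  opnorm2 (flatten1 S) / tnorm2 S.

Lemma rho_gt0 a b c (S : tensor R a b c) : S != 0 -> 0 < rho S.
Proof.
rewrite -tnorm2_gt0 => S0; rewrite divr_gt0 //.
have := frob2_le_opnorm2 (flatten1 S); rewrite frob2_flatten1.
move=> /(lt_le_trans S0); rewrite lt_def mulf_eq0 negb_or.
by move=> /andP[/andP[_ +] _]; rewrite lt_def opnorm2_ge0 andbT.
Qed.

(** The largest of [a] squared singular values is at least their average. *)
Lemma rho_ge_invr a b c (S : tensor R a b c) : S != 0 -> a%:R^-1 <= rho S.
Proof.
move=> Sn0; have := Sn0; rewrite -tnorm2_gt0 => S0.
have := frob2_le_opnorm2 (flatten1 S); rewrite frob2_flatten1 => le_opnorm2.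
have [a0|a0] := posnP a.
  have /eqP-> : a%:R == 0 :> R by rewrite pnatr_eq0 a0.
  by rewrite invr0 ltW ?rho_gt0.
rewrite /rho ler_pdivlMr // ler_pdivrMl ?ltr0n //.
Qed.

Lemma swap12_eq0 a b c (S : tensor R a b c) : (swap12 S == 0) = (S == 0).
Proof. by rewrite -!tnorm2_eq0 tnorm2_swap12. Qed.

Lemma rot3_eq0 a b c (S : tensor R a b c) : (rot3 S == 0) = (S == 0).
Proof. by rewrite -!tnorm2_eq0 tnorm2_rot3. Qed.

Context (theta : 'I_3 -> R) (theta_ge0 : forall i, 0 <= theta i).

(* The objective of [F_min_entropy] at the point of the moment polytope given
   by [S], see [powR_min_entropy]. *)
Definition value a b c (S : tensor R a b c) : R :=
  expR (- (theta 0 * ln (rho S) + theta 1 * ln (rho (swap12 S))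
           + theta 2 * ln (rho (rot3 S)))).

Lemma sum_theta : \sum_(i < 3) theta i = theta 0 + theta 1 + theta 2.
Proof.
rewrite !big_ord_recr big_ord0 /= add0r.
by congr (theta _ + theta _ + theta _); apply: val_inj.
Qed.

Lemma value_gt0 a b c (S : tensor R a b c) : 0 < value S.
Proof. exact: expR_gt0. Qed.

Lemma powR_min_entropy a b c (S : tensor R a b c) :
  2 `^ (theta 0 * min_entropy (spec (flatten1 S))
        + theta 1 * min_entropy (spec (flatten2 S))
        + theta 2 * min_entropy (spec (flatten3 S))) = value S.
Proof.
have ln2 : ln 2 != 0 :> R by rewrite gt_eqF // ln_gt0 // ltr1n.
rewrite /powR pnatr_eq0 /= /value /min_entropy /log2 !max_spec.
rewrite flatten2E flatten3E !frob2_flatten1 -/(rho S) -/(rho (swap12 S)).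
by rewrite -/(rho (rot3 S)); congr expR; field.
Qed.

Lemma rho_kron a b c a' b' c' (S : tensor R a b c) (T : tensor R a' b' c') :
  rho (tkron S T) <= rho S * rho T.
Proof.
rewrite /rho tnorm2_kron mulrACA -invfM ler_wpM2r ?opnorm2_kron //.
by rewrite invr_ge0 mulr_ge0 ?tnorm2_ge0.
Qed.

Lemma tkron_eq0 a b c a' b' c' (S : tensor R a b c) (T : tensor R a' b' c') :
  (tkron S T == 0) = (S == 0) || (T == 0).
Proof. by rewrite -!tnorm2_eq0 tnorm2_kron mulf_eq0. Qed.

(** The sign in [value] reverses [rho_kron], used in each mode with a nonnegative weight. Nonzero
    tensors keep [rho] positive, where [ln] is monotone and additive. *)
Lemma value_kron a b c a' b' c' (S : tensor R a b c) (T : tensor R a' b' c') :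
  S != 0 -> T != 0 -> value S * value T <= value (tkron S T).
Proof.
move=> S0 T0; rewrite -expRD ler_expR -opprD lerN2.
have leg (a1 b1 c1 a2 b2 c2 : nat) (S1 : tensor R a1 b1 c1)
    (T1 : tensor R a2 b2 c2) : S1 != 0 -> T1 != 0 ->
    ln (rho (tkron S1 T1)) <= ln (rho S1) + ln (rho T1).
  move=> S10 T10.
  have rS := rho_gt0 S10; have rT := rho_gt0 T10.
  have rST : 0 < rho (tkron S1 T1) by rewrite rho_gt0 // tkron_eq0 negb_or S10.
  by rewrite -lnM // ler_ln ?rho_kron // posrE mulr_gt0.
have -> : swap12 (tkron S T) = tkron (swap12 S) (swap12 T) by [].
have -> : rot3 (tkron S T) = tkron (rot3 S) (rot3 T) by [].
rewrite addrACA [X in _ <= X + _]addrACA -!mulrDr.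
have S2 : swap12 S != 0 by rewrite swap12_eq0.
have T2 : swap12 T != 0 by rewrite swap12_eq0.
have S3 : rot3 S != 0 by rewrite rot3_eq0.
have T3 : rot3 T != 0 by rewrite rot3_eq0.
apply: lerD; last exact: ler_wpM2l (leg _ _ _ _ _ _ _ _ S3 T3).
apply: lerD; first exact: ler_wpM2l (leg _ _ _ _ _ _ _ _ S0 T0).
exact: ler_wpM2l (leg _ _ _ _ _ _ _ _ S2 T2).
Qed.

Lemma value_gram a b c a1 b1 c1 a2 b2 c2 (A : 'M[C]_(a1, a))
    (B : 'M[C]_(b1, b)) (D : 'M[C]_(c1, c)) (A' : 'M[C]_(a2, a))
    (B' : 'M[C]_(b2, b)) (D' : 'M[C]_(c2, c)) (T : tensor R a b c) :
    A^t* *m A = A'^t* *m A' -> B^t* *m B = B'^t* *m B' ->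
    D^t* *m D = D'^t* *m D' ->
  value (tapply A B D T) = value (tapply A' B' D' T).
Proof.
move=> AA BB DD; rewrite /value !swap12_tapply !rot3_tapply /rho.
have [-> ->] := tapply_gram T AA BB DD.
have [-> ->] := tapply_gram (swap12 T) BB AA DD.
by have [-> ->] := tapply_gram (rot3 T) DD AA BB.
Qed.

Definition tscale a b c (z : C) (S : tensor R a b c) : tensor R a b c :=
  fun i j k => z * S i j k.

Lemma tnorm2_scale a b c z (S : tensor R a b c) :
  tnorm2 (tscale z S) = abs2 z * tnorm2 S.
Proof.
rewrite -!frob2_flatten1 -frob2Z; congr frob2.
by apply/matrixP => i l; rewrite !mxE.
Qed.

Lemma tscale_tapply a b c z a' b' c' (A : 'M[C]_(a', a)) (B : 'M[C]_(b', b))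
    (D : 'M[C]_(c', c)) (T : tensor R a b c) :
  tscale z (tapply A B D T) = tapply (z *: A) B D T.
Proof.
apply: flatten1_inj; rewrite flatten1_tapply -!scalemxAl -flatten1_tapply.
by apply/matrixP => i l; rewrite !mxE.
Qed.

Lemma rho_scale a b c z (S : tensor R a b c) : z != 0 ->
  rho (tscale z S) = rho S.
Proof.
move=> z0.
have az : abs2 z != 0.
  by rewrite -(inj_eq (@complexI _)) abs2E sqrf_eq0 normr_eq0.
have fl w (U : tensor R a b c) : flatten1 (tscale w U) = w *: flatten1 U.
  by apply/matrixP => i l; rewrite !mxE.
rewrite /rho tnorm2_scale fl.
suff -> : opnorm2 (z *: flatten1 S) = abs2 z * opnorm2 (flatten1 S).
  by rewrite -mulf_div divff // mul1r.
(* The reverse inequality is [opnorm2Z_le] for the scalar [z^-1]. *)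
apply/eqP; rewrite eq_le opnorm2Z_le /= -ler_pdivlMl; last first.
  by rewrite lt_def az abs2_ge0.
rewrite -{1}[flatten1 S]scale1r -(mulVf z0) -scalerA.
rewrite (le_trans (opnorm2Z_le _ _)) //.
suff -> : abs2 z^-1 = (abs2 z)^-1 by [].
by apply: complexI; rewrite fmorphV /= !abs2E normfV exprVn.
Qed.

Lemma value_scale a b c z (S : tensor R a b c) : z != 0 ->
  value (tscale z S) = value S.
Proof.
move=> z0; rewrite /value rho_scale //.
have -> : swap12 (tscale z S) = tscale z (swap12 S) by [].
have -> : rot3 (tscale z S) = tscale z (rot3 S) by [].
by rewrite !rho_scale.
Qed.

(** Each [rho] is at least the inverse of [r], and the weights sum to 1. *)
Lemma value_le_dim r (S : tensor R r r r) : \sum_(i < 3) theta i = 1 ->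
  S != 0 -> value S <= r%:R.
Proof.
move=> th1 S0; have [r0|r0] := posnP r.
  exfalso; move: S S0; rewrite r0 => S /eqP; apply.
  by apply/funext => -[].
have rR : 0 < r%:R :> R by rewrite ltr0n.
have leg (S1 : tensor R r r r) : S1 != 0 -> - ln (r%:R) <= ln (rho S1).
  move=> S10; rewrite -lnV ?posrE //.
  by rewrite ler_ln ?posrE ?invr_gt0 ?rho_gt0 // rho_ge_invr.
rewrite -[leRHS]lnK ?posrE // ler_expR lerNl.
have -> : - ln r%:R = theta 0 * - ln r%:R + theta 1 * - ln r%:R
    + theta 2 * - ln r%:R.
  rewrite -!mulrDl -[LHS]mul1r; congr (_ * _); rewrite -th1.
  by rewrite sum_theta.
have S2 : swap12 S != 0 by rewrite swap12_eq0.
have S3 : rot3 S != 0 by rewrite rot3_eq0.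
apply: lerD; last exact: ler_wpM2l (leg _ S3).
by apply: lerD; [exact: ler_wpM2l (leg _ S0) | exact: ler_wpM2l (leg _ S2)].
Qed.

Lemma unit_tensor_neq0 r : (0 < r)%N -> unit_tensor R r != 0.
Proof.
move=> r0; pose i := Ordinal r0.
apply/eqP => /(congr1 (fun S => S i i i)).
by rewrite /unit_tensor eqxx => /eqP; rewrite oner_eq0.
Qed.

(** The flattening has orthonormal rows, hence operator norm at most 1, while the squared norm of
    the tensor is [r]. By symmetry all three modes agree. *)
Lemma value_unit_tensor r : \sum_(i < 3) theta i = 1 -> (0 < r)%N ->
  value (unit_tensor R r) = r%:R.
Proof.
move=> th1 r0; apply/eqP; rewrite eq_le value_le_dim ?unit_tensor_neq0 //=.
have rR : 0 < r%:R :> R by rewrite ltr0n.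
have abs2n (x : bool) : abs2 (x%:R : C) = x%:R.
  by case: x; rewrite /abs2 /= ?expr1n ?expr0n ?addr0.
have tn : tnorm2 (unit_tensor R r) = r%:R.
  rewrite /tnorm2 -[in RHS](card_ord r) -sum1_card natr_sum.
  apply: eq_bigr => i _.
  rewrite (bigD1 i) //= [X in _ + X]big1 => [|j ji]; last first.
    apply: big1 => k _; rewrite /unit_tensor abs2n eq_sym (negPf ji) //.
  rewrite addr0 (bigD1 i) //= [X in _ + X]big1 => [|j ji]; last first.
    by rewrite /unit_tensor abs2n eqxx eq_sym (negPf ji).
  by rewrite addr0 /unit_tensor abs2n !eqxx.
have gram :
    flatten1 (unit_tensor R r) *m (flatten1 (unit_tensor R r))^t* = 1%:M.
  apply/matrixP => i i'; rewrite mxE big_mxtens_index [RHS]mxE.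
  rewrite (bigD1 i) //= [X in _ + X]big1 => [|j ji]; last first.
    apply: big1 => k _; rewrite !mxE !mxtens_indexK /unit_tensor /=.
    by rewrite eq_sym (negPf ji) mul0r.
  rewrite addr0 (bigD1 i) //= [X in _ + X]big1 => [|k ki]; last first.
    rewrite !mxE !mxtens_indexK /unit_tensor /=.
    by rewrite eqxx eq_sym (negPf ki) mul0r.
  rewrite addr0 !mxE !mxtens_indexK /unit_tensor /= !eqxx mul1r andbT.
  by rewrite conjC_nat eq_sym.
have rho1 : rho (unit_tensor R r) <= r%:R^-1.
  rewrite /rho tn ler_piMl ?invr_ge0 ?ler0n //; apply: opnorm2_le => // x.
  rewrite mul1r (@frob2_gram _ _ _ _ _ x) // mul_adj mulmxA.
  by rewrite -[x *m _ *m _]mulmxA gram mulmx1.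
have leg : ln (rho (unit_tensor R r)) <= - ln r%:R.
  by rewrite -lnV ?posrE // ler_ln ?posrE ?invr_gt0 ?rho_gt0 ?unit_tensor_neq0.
have -> : value (unit_tensor R r) = expR (- ln (rho (unit_tensor R r))).
  have sw : swap12 (unit_tensor R r) = unit_tensor R r.
    apply/funext => i; apply/funext => j; apply/funext => k.
    rewrite /swap12 /unit_tensor eq_sym; case: eqP => [->|] //.
  have ro : rot3 (unit_tensor R r) = unit_tensor R r.
    apply/funext => i; apply/funext => j; apply/funext => k.
    rewrite /rot3 /unit_tensor.
    by case: (eqVneq j k) => [->|_]; rewrite ?andbT ?andbF //= eq_sym.
  rewrite /value sw ro -!mulrDl; congr (expR (- _)).
  rewrite -[RHS]mul1r -th1; congr (_ * _).
  by rewrite sum_theta.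
by rewrite -[leLHS]lnK ?posrE // ler_expR lerNr.
Qed.
End Values.

(** * Continuity, compactness and existence of the maximum *)

Section Topology.
Context {R : realType}.
Local Notation C := R[i].

Lemma Re_continuous : continuous (fun z : C^o => complex.Re z : R).
Proof.
move=> z; apply/(@cvgrPdist_lt _ R _ _ (nbhs_filter z)) => e e0.
have eC : (0 : C) < e%:C by rewrite ltcR.
apply: (@filterS _ _ (nbhs_filter z) _ _ _ (@nbhsx_ballx _ C^o z _ eC)).
move=> w /= zw.
rewrite -raddfB /= -ltcR; apply: le_lt_trans zw; exact: normc_ge_Re.
Qed.

Lemma real_complex_continuous : continuous (fun x : R => x%:C : C^o).
Proof.
move=> x; apply/cvgrPdist_lt => -[e e'] /=.
rewrite ltcE /= => /andP[/eqP -> e0].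
apply: filterS (@nbhsx_ballx _ R x _ e0) => y /= xy.
by rewrite -rmorphB normc_def /= expr0n addr0 sqrtr_sqr ltcR.
Qed.

Lemma sum_continuous (K : numFieldType) (V : normedModType K)
    (X : topologicalType) (I : finType) (f : I -> X -> V) :
  (forall i, continuous (f i)) -> continuous (fun x => \sum_i f i x).
Proof. by move=> cf; apply: continuous_big => // x; exact: add_continuous. Qed.

Lemma mulc_continuous (X : topologicalType) (f g : X -> C^o) :
  continuous f -> continuous g -> continuous (fun x => f x * g x : C^o).
Proof. by move=> cf cg x; exact: cvgM (cf x) (cg x). Qed.

Lemma addc_continuous (X : topologicalType) (f g : X -> C^o) :
  continuous f -> continuous g -> continuous (fun x => f x + g x : C^o).
Proof. by move=> cf cg x; exact: cvgD (cf x) (cg x). Qed.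

Lemma Im_continuous : continuous (fun z : C^o => complex.Im z : R).
Proof.
pose mulNi (z : C^o) : C^o := - ('i%C : C^o) * z.
have -> : (fun z : C^o => complex.Im z : R) =
    (@complex.Re R : C^o -> R) \o mulNi.
  apply/funext => z; rewrite /mulNi /=.
  rewrite (_ : _ * _ = - (z * 'i%C)) 1?raddfN /= ?ReiNIm ?opprK //.
  by rewrite mulNr mulrC.
move=> z; apply: (@continuous_comp _ _ _ mulNi).
  move: z; apply: mulc_continuous => z; first exact: cst_continuous.
  exact: cvg_id.
exact: Re_continuous.
Qed.

Lemma abs2_continuous : continuous (fun z : C^o => abs2 z : R).
Proof.
have -> : (fun z : C^o => abs2 z : R) = (fun z : C^o =>
    complex.Re z * complex.Re z + complex.Im z * complex.Im z).
  by apply/funext => z; rewrite /abs2 !expr2.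
have cRe := Re_continuous; have cIm := Im_continuous => z.
exact: (@cvgD _ R _ _ _ _ _ _ _ (cvgM (cRe z) (cRe z)) (cvgM (cIm z) (cIm z))).
Qed.

(** The disc lies in a square, which is a continuous image of a product of two real segments. *)
Lemma compact_unit_disc : exists2 B : set C^o, compact B &
  forall z, abs2 z <= 1 -> B z.
Proof.
pose f (xy : R * R) : C^o := (xy.1)%:C + ('i%C : C^o) * (xy.2)%:C.
exists (f @` (`[-1, 1] `*` `[-1, 1])).
  apply: continuous_compact.
    apply: continuous_subspaceT; apply: addc_continuous.
      move=> xy; apply: (@continuous_comp _ _ _ fst (fun x : R => x%:C : C^o)).
        exact: cvg_fst.
      exact: real_complex_continuous.
    apply: mulc_continuous => xy; first exact: cst_continuous.
    apply: (@continuous_comp _ _ _ snd (fun x : R => x%:C : C^o)).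
      exact: cvg_snd.
    exact: real_complex_continuous.
  by apply: compact_setX; exact: segment_compact.
move=> z; rewrite /abs2 => z1; exists (complex.Re z, complex.Im z); last first.
  by rewrite /f /= -complexE.
have := sqr_ge0 (complex.Re z); have := sqr_ge0 (complex.Im z) => y0 x0.
by split; rewrite /= in_itv /= -ler_norml -(ler_sqr (x := `|_|)) ?nnegrE //
  ?expr1n ?real_normK ?num_real //; lra.
Qed.

(** The product topology is the supremum of the initial topologies of the projections, so
    convergence is tested on coordinates. *)
Lemma cvg_prod_topology (I : Type) (K : I -> topologicalType) (X : Type)
    (F : set_system X) (h : X -> prod_topology K) (f : prod_topology K) :
  Filter F -> (forall i, (fun x => h x i) @ F --> f i) -> h @ F --> f.
Proof.
move=> FF hf; apply/cvg_sup => i U.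
have /= -> := @nbhsE (initial_topology (fun g : prod_topology K => g i)) f.
case=> B [[V oV <-] fV] /filterS; apply; apply: hf.
exact: open_nbhs_nbhs.
Qed.

Lemma cvg_tensor a b c (X : Type) (F : set_system X)
    (h : X -> tensor R a b c) (S : tensor R a b c) :
  Filter F -> (forall i j k, (fun x => h x i j k) @ F --> S i j k) ->
  h @ F --> S.
Proof.
move=> FF hS; apply: (@cvg_prod_topology _ (fun _ => 'I_b -> 'I_c -> C^o)) => i.
apply: (@cvg_prod_topology _ (fun _ => 'I_c -> C^o)) => j.
by apply: (@cvg_prod_topology _ (fun _ => C^o)) => k.
Qed.

Lemma tensor_continuous a b c (X : topologicalType) (h : X -> tensor R a b c) :
  (forall i j k, continuous (fun x => h x i j k : C^o)) -> continuous h.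
Proof.
move=> ch x; apply: (cvg_tensor (nbhs_filter x)) => i j k; exact: ch.
Qed.

Lemma entry_continuous a b c i j k :
  continuous (fun S : tensor R a b c => S i j k : C^o).
Proof.
move=> S.
apply: (@continuous_comp _ _ _ (fun S : tensor R a b c => S i j) (@^~ k)).
  apply: (@continuous_comp _ _ _ (fun S : tensor R a b c => S i) (@^~ j)).
    exact: (@proj_continuous _ (fun _ : 'I_a => 'I_b -> 'I_c -> C^o)).
  exact: (@proj_continuous _ (fun _ : 'I_b => 'I_c -> C^o)).
exact: (@proj_continuous _ (fun _ : 'I_c => C^o)).
Qed.

Lemma swap12_continuous a b c : continuous (@swap12 R a b c).
Proof. by apply: tensor_continuous => i j k; exact: entry_continuous. Qed.

Lemma rot3_continuous a b c : continuous (@rot3 R a b c).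
Proof. by apply: tensor_continuous => i j k; exact: entry_continuous. Qed.

Lemma tscale_continuous a b c z : continuous (@tscale R a b c z).
Proof.
apply: tensor_continuous => i j k.
apply: mulc_continuous => S; first exact: cst_continuous.
exact: entry_continuous.
Qed.

Lemma tdist_continuous a b c (S0 : tensor R a b c) :
  continuous (fun S => tnorm2 (S - S0)).
Proof.
apply: sum_continuous => i; apply: sum_continuous => j.
apply: sum_continuous => k S.
apply: (@continuous_comp _ _ _
  (fun T : tensor R a b c => (T - S0) i j k : C^o)).
  move: S; apply: addc_continuous => S; last exact: cst_continuous.
  exact: entry_continuous.
exact: abs2_continuous.
Qed.

Lemma tnorm2_continuous a b c : continuous (@tnorm2 R a b c).
Proof.
have -> : @tnorm2 R a b c = (fun S => tnorm2 (S - 0)).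
  by apply/funext => S; rewrite subr0.
exact: tdist_continuous.
Qed.

(** The square root of [opnorm2] is 1-Lipschitz for the Euclidean norm by [sqrt_opnorm2_dist]; then
    square. *)
Lemma opnorm2_continuous a b c :
  continuous (fun S : tensor R a b c => opnorm2 (flatten1 S)).
Proof.
move=> S.
pose s (T : tensor R a b c) : R := Num.sqrt (opnorm2 (flatten1 T)).
have E : (fun S : tensor R a b c => opnorm2 (flatten1 S)) =
    (fun S => s S * s S).
  by apply/funext => T; rewrite /s -expr2 sqr_sqrtr ?opnorm2_ge0.
suff cs : continuous s.
  by rewrite E; exact: cvgM (cs S) (cs S).
move=> {E} {}S.
have d0 : (fun T : tensor R a b c => Num.sqrt (tnorm2 (T - S))) @ S --> (0 : R).
  have : continuous_at S (fun T : tensor R a b c => Num.sqrt (tnorm2 (T - S))).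
    apply: (@continuous_comp _ _ _
      (fun T : tensor R a b c => tnorm2 (T - S)) Num.sqrt).
      exact: tdist_continuous.
    exact: sqrt_continuous.
  rewrite /continuous_at subrr.
  have /eqP-> : tnorm2 (0 : tensor R a b c) == 0 by rewrite tnorm2_eq0.
  by rewrite sqrtr0.
apply/(@cvgrPdist_lt _ R _ _ (nbhs_filter S)) => e e0.
have := cvgr0_norm_lt (FF := nbhs_filter S) _ d0 _ e0.
apply: (@filterS _ _ (nbhs_filter S)) => T.
rewrite /= ger0_norm ?sqrtr_ge0 //.
apply: le_lt_trans; rewrite distrC (le_trans (sqrt_opnorm2_dist _ _)) //.
rewrite -frob2_flatten1 ler_wsqrtr // le_eqVlt; apply/orP; left; apply/eqP.
by congr frob2; apply/matrixP => i l; rewrite !mxE.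
Qed.

Lemma rho_continuous a b c (S : tensor R a b c) : S != 0 ->
  {for S, continuous (@rho R a b c)}.
Proof.
rewrite -tnorm2_gt0 => S0.
exact: cvgM (@opnorm2_continuous a b c S)
  (cvgV (lt0r_neq0 S0) (@tnorm2_continuous a b c S)).
Qed.

Lemma ln_rho_continuous a b c (S : tensor R a b c) : S != 0 ->
  {for S, continuous (fun T : tensor R a b c => ln (rho T))}.
Proof.
move=> S0; apply: (@continuous_comp _ _ _ (@rho R a b c) (@ln R)).
  exact: rho_continuous.
exact: continuous_ln (rho_gt0 S0).
Qed.

Context (theta : 'I_3 -> R).

Lemma value_continuous a b c (S : tensor R a b c) : S != 0 ->
  {for S, continuous (@value R theta a b c)}.
Proof.
move=> S0.
have S2 : swap12 S != 0 by rewrite swap12_eq0.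
have S3 : rot3 S != 0 by rewrite rot3_eq0.
have c1 := ln_rho_continuous S0.
have c2 := continuous_comp (@swap12_continuous a b c S) (ln_rho_continuous S2).
have c3 := continuous_comp (@rot3_continuous a b c S) (ln_rho_continuous S3).
have ct i : {for S, continuous (fun _ : tensor R a b c => theta i)}.
  exact: cst_continuous.
pose f (T : tensor R a b c) := - (theta 0 * ln (rho T)
  + theta 1 * ln (rho (swap12 T)) + theta 2 * ln (rho (rot3 T))).
apply: (@continuous_comp _ _ _ f (@expR R)); last exact: continuous_expR.
exact: cvgN (cvgD (cvgD (cvgM (ct 0) c1) (cvgM (ct 1) c2)) (cvgM (ct 2) c3)).
Qed.

(** Scaling is continuous and preserves the orbit, since the scalar can be absorbed into the first
    matrix. *)
Lemma closure_tscale a b c (T S : tensor R a b c) (z : C) : z != 0 ->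
  closure (GL_orbit T) S -> closure (GL_orbit T) (tscale z S).
Proof.
move=> z0 clS B /tscale_continuous.
move=> /clS[_ [[A [A' [A'' [uA uA' uA'' ->]]]] BS]].
exists (tscale z (tapply A A' A'' T)); split=> //.
exists (z *: A), A', A''; split=> //; last exact: tscale_tapply.
by rewrite unitmxZ // unitfE.
Qed.

(** If the value at [S] exceeded [m], then by continuity so would the value at some point of the
    orbit near [S]. *)
Lemma closure_value_le a b c (T : tensor R a b c) m :
  (forall S, GL_orbit T S -> value theta S <= m) ->
  forall S, closure (GL_orbit T) S -> S != 0 -> value theta S <= m.
Proof.
move=> Tm S clS S0; rewrite leNgt; apply/negP => mS.
have /clS[S' [TS' /=]] : nbhs S [set S' | m < value theta S'].
  apply: (@cvgr_gt _ _ _ (nbhs_filter S) _ _ (value_continuous S0)) => //.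
by rewrite ltNge Tm.
Qed.

Lemma GL_orbit_neq0 a b c (T S : tensor R a b c) :
  T != 0 -> GL_orbit T S -> S != 0.
Proof.
move=> + [A [B [D [uA uB uD ->]]]]; apply: contra_neq => T0.
have: tapply (invmx A) (invmx B) (invmx D) (tapply A B D T) = 0.
  by rewrite T0 tapply0.
by rewrite tapply_comp !mulVmx // tapply1.
Qed.

(** Scale invariance reduces the problem to the unit sphere of the orbit closure, which is compact
    and avoids 0, so the continuous [value] attains its maximum there. *)
Lemma value_max a b c (T : tensor R a b c) : T != 0 ->
  exists S, [/\ closure (GL_orbit T) S, S != 0 &
    forall S', closure (GL_orbit T) S' -> S' != 0 ->
      value theta S' <= value theta S].
Proof.
move=> T0; have [B cB discB] := compact_unit_disc.
pose K := closure (GL_orbit T) `&` [set S | tnorm2 S = 1].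
have normalize (S : tensor R a b c) : S != 0 -> exists2 z : C, z != 0 &
    tnorm2 (tscale z S) = 1.
  rewrite -tnorm2_gt0 => S0.
  have sS : 0 < Num.sqrt (tnorm2 S) by rewrite sqrtr_gt0.
  exists ((Num.sqrt (tnorm2 S))^-1)%:C.
    by rewrite (inj_eq (@complexI R)) invr_eq0 gt_eqF.
  rewrite tnorm2_scale /abs2 /= expr0n addr0 exprVn sqr_sqrtr ?ltW //.
  by rewrite mulVf ?gt_eqF.
have TT : GL_orbit T T.
  exists 1%:M, 1%:M, 1%:M; split; rewrite ?unitmx1 ?tapply1 //.
have cK : compact K.
  apply: (@subclosed_compact _ _
    [set S : tensor R a b c | forall i j k, B (S i j k)]).
  - apply: closedI; first exact: closed_closure.
    apply: (@preimage_closed _ _ (@tnorm2 R a b c) [set x | x = 1]).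
      by move=> S _; exact: tnorm2_continuous.
    exact: closed_eq.
  (* Tensors with all entries in the compact set [B] form a compact set, by Tychonoff in each of the
     three indices. *)
  - have := @tychonoff 'I_a (fun _ => 'I_b -> 'I_c -> C^o)
      (fun _ => [set f | forall j k, B (f j k)]); apply => _.
    have := @tychonoff 'I_b (fun _ => 'I_c -> C^o)
      (fun _ => [set f | forall k, B (f k)]); apply => _.
    by have := @tychonoff 'I_c (fun _ => C^o) (fun _ => B); apply.
  - move=> S [_ /= S1] i j k; apply: discB.
    by rewrite -S1 abs2_le_tnorm2.
have K0 : K !=set0.
  have [z z0 z1] := normalize T T0; exists (tscale z T); split=> //.
  exact/closure_tscale/subset_closure.
have K_neq0 S : K S -> S != 0.
  by move=> [_ /= S1]; rewrite -tnorm2_eq0 S1 oner_eq0.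
have [|S SK Smax] := @compact_EVT_max _ R (@value R theta a b c) K K0 cK.
  apply: continuous_in_subspaceT => S /set_mem /K_neq0; exact: value_continuous.
exists S; split; [by case: (set_mem SK) | exact: K_neq0 (set_mem SK)|].
move=> S' clS' S'0; have [z z0 z1] := normalize S' S'0.
rewrite -(value_scale theta S' z0) Smax //; apply/mem_set; split=> //.
exact: closure_tscale.
Qed.

End Topology.

(** * The functional as a maximum over restrictions *)

Section Functional.
Context {R : realType}.
Local Notation C := R[i].

Lemma closure_line a b c (T : tensor R a b c) (A A' : 'M[C]_a)
    (B B' : 'M[C]_b) (D D' : 'M[C]_c) :
    (forall e : R, 0 < e -> A + e%:C *: A' \in unitmx) ->
    (forall e : R, 0 < e -> B + e%:C *: B' \in unitmx) ->
    (forall e : R, 0 < e -> D + e%:C *: D' \in unitmx) ->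
  closure (GL_orbit T) (tapply A B D T).
Proof.
move=> uA uB uD.
pose f (e : R) : tensor R a b c :=
  tapply (A + e%:C *: A') (B + e%:C *: B') (D + e%:C *: D') T.
have f0 : f 0 = tapply A B D T by rewrite /f !scale0r !addr0.
have cf : continuous f.
  have line n (M M' : 'M[C]_n) i j :
      continuous (fun e : R => (M + e%:C *: M') i j : C^o).
    have -> : (fun e : R => (M + e%:C *: M') i j : C^o) =
        (fun e : R => M i j + e%:C * M' i j).
      by apply/funext => e; rewrite !mxE.
    apply: addc_continuous; first by move=> e; exact: cst_continuous.
    apply: mulc_continuous; first exact: real_complex_continuous.
    by move=> e; exact: cst_continuous.
  apply: tensor_continuous => i' j' k'.
  apply: (@sum_continuous C C^o) => i; apply: (@sum_continuous C C^o) => j.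
  apply: (@sum_continuous C C^o) => k.
  apply: mulc_continuous; last by move=> e; exact: cst_continuous.
  by apply: mulc_continuous; [apply: mulc_continuous|]; exact: line.
move=> U; rewrite -f0 => /cf /(@nbhs_ballP R R)[e /= e0 eU].
(* Half the radius is positive, so [f] lands in the orbit, and lies strictly inside the ball. *)
exists (f (e / 2)); split; last first.
  by apply: eU; rewrite /ball /= sub0r normrN ger0_norm; lra.
have e20 : 0 < e / 2 by rewrite divr_gt0.
exists (A + (e / 2)%:C *: A'), (B + (e / 2)%:C *: B'),
  (D + (e / 2)%:C *: D').
by split => //; [exact: uA | exact: uB | exact: uD].
Qed.

Context (theta : 'I_3 -> R).

(** Since [value_max] provides a greatest element, [xget] returns it and not its default. *)
Lemma F_min_entropyP a b c (T : tensor R a b c) : T != 0 ->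
  exists2 S, closure (GL_orbit T) S /\ S != 0 &
    F_min_entropy theta T = value theta S /\
    forall S', closure (GL_orbit T) S' -> S' != 0 ->
      value theta S' <= value theta S.
Proof.
move=> T0; have [S [clS S0 Smax]] := value_max theta T0.
exists S => //; split=> //; rewrite /F_min_entropy /maximum.
set V := [set _ | _ in _].
have max_S : [set m | V m /\ ubound V m] (value theta S).
  split.
    exists (spec (flatten1 S), spec (flatten2 S), spec (flatten3 S)).
      by exists S.
    exact: powR_min_entropy.
  move=> _ [_ [S' [clS' S'0] <-] <-] /=.
  by rewrite powR_min_entropy; exact: Smax.
have [VF uF] := xgetI 0 max_S; case: max_S => VS uS.
by apply/eqP; rewrite eq_le uF // uS.
Qed.

Lemma F_min_entropy_le a b c (T : tensor R a b c) m : T != 0 ->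
  (forall S, GL_orbit T S -> value theta S <= m) ->
  F_min_entropy theta T <= m.
Proof.
move=> /F_min_entropyP[S [clS S0] [-> _]] Tm.
exact: closure_value_le Tm _ clS S0.
Qed.

(** Rectangular matrices may leave the tensor space of [T]. Replacing each by a square matrix with
    the same Gram matrix keeps the value and the norm, and [closure_line] puts the new tensor in the
    orbit closure. *)
Lemma value_le_F_min_entropy a b c a' b' c' (A : 'M[C]_(a', a))
    (B : 'M[C]_(b', b)) (D : 'M[C]_(c', c)) (T : tensor R a b c) :
  tapply A B D T != 0 -> value theta (tapply A B D T) <= F_min_entropy theta T.
Proof.
move=> AT0.
have T0 : T != 0 by apply: contra_neq AT0 => ->; exact: tapply0.
have [S _ [-> Smax]] := F_min_entropyP T0.
have [A1 [A2 [EA uA]]] := gram_root A.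
have [B1 [B2 [EB uB]]] := gram_root B.
have [D1 [D2 [ED uD]]] := gram_root D.
rewrite (value_gram theta T EA EB ED); apply: Smax.
  exact: closure_line uA uB uD.
by rewrite -tnorm2_gt0 -(tapply_gram T EA EB ED).2 tnorm2_gt0.
Qed.

End Functional.

Theorem theorem5p7 (R : realType) (theta : 'I_3 -> R) (theta_in : Theta theta) :
  (forall (a b c a' b' c' : nat)
      (S : tensor R a b c) (T : tensor R a' b' c'),
    S != 0 -> T != 0 -> tensor_le S T ->
    F_min_entropy theta S <= F_min_entropy theta T)
  /\ (forall r : nat, F_min_entropy theta (unit_tensor R r) = r%:R)
  /\ (forall (a b c a' b' c' : nat)
        (S : tensor R a b c) (T : tensor R a' b' c'),
      S != 0 -> T != 0 ->
      F_min_entropy theta S * F_min_entropy theta T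
        <= F_min_entropy theta (tkron S T)).
Proof.
have [theta_ge0 theta1] := theta_in.
split=> [a b c a' b' c' S T S0 T0 [A [B [D ST]]]|].
  apply: F_min_entropy_le => // S' S'orb.
  have := GL_orbit_neq0 S0 S'orb.
  (* A point of the orbit of [S] is itself a restriction of [T]. *)
  case: S'orb => [A' [B' [D' [_ _ _ ->]]]]; rewrite ST tapply_comp.
  exact: value_le_F_min_entropy.
split=> [r|a b c a' b' c' S T S0 T0].
  (* For [r] equal to 0 every tensor is zero, the moment polytope is empty, and the default 0 of
     [maximum] is the required value. *)
  have [->|r0] := posnP r.
    rewrite /F_min_entropy /maximum xgetPN // => m [[_ [S [_ /eqP S0] _] _] _].
    by apply: S0; apply/funext => -[].
  have U0 := @unit_tensor_neq0 R r r0.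
  apply/eqP; rewrite eq_le F_min_entropy_le //=; last first.
    by move=> S /(GL_orbit_neq0 U0); exact: value_le_dim.
  have := @value_le_F_min_entropy R theta _ _ _ _ _ _
    1%:M 1%:M 1%:M (unit_tensor R r).
  by rewrite tapply1 value_unit_tensor //; apply.
have FT0 : 0 < F_min_entropy theta T.
  by have [S' _ [-> _]] := F_min_entropyP theta T0; exact: value_gt0.
(* Dividing by the other positive factor isolates first the functional at [S], then at [T], so that
   each can be bounded over its orbit. *)
rewrite -ler_pdivlMr //; apply: F_min_entropy_le => // S' orbS.
rewrite ler_pdivlMr // -ler_pdivlMl ?value_gt0 //.
apply: F_min_entropy_le => // T' orbT; rewrite ler_pdivlMl ?value_gt0 //.
have S'0 := GL_orbit_neq0 S0 orbS; have T'0 := GL_orbit_neq0 T0 orbT.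
apply: (le_trans (value_kron theta_ge0 S'0 T'0)).
have : tkron S' T' != 0 by rewrite tkron_eq0 negb_or S'0.
case: orbS orbT => [A [B [D [_ _ _ ->]]]] [A' [B' [D' [_ _ _ ->]]]].
rewrite -tapply_kron; exact: value_le_F_min_entropy.
Qed.
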